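(* Consider testing $H_0:\boldsymbol\theta=\mathbf 0$ versus $H_1:\boldsymbol\theta\neq\mathbf 0$ where, under $H_1$, $\boldsymbol\theta\mid g,\boldsymbol\gamma_1,\sigma_1^2\sim N_{r_1}(\mathbf 0,g\sigma_1^2\boldsymbol\Omega)$, $\pi_1(\boldsymbol\gamma_1)\propto1$, $\sigma_1^2\sim\text{inv-}\chi^2(s_1^2,\nu_1)$; and, under $H_0$, $\pi_0(\boldsymbol\gamma_0)\propto1$ and $\sigma_0^2\sim\text{inv-}\chi^2(s_0^2,\nu_0)$. Let $B_{10}(g)$ be the Bayes factor for fixed $g$. If $g>0$ is set by maximizing $B_{10}(g)$ (for each data set), so that the Bayes factor used is $\sup_{g>0}B_{10}(g)$, then information consistency holds.
   Context: Model: $\mathbf y=\mathbf X_{\boldsymbol\theta}\boldsymbol\theta+\mathbf X_{\boldsymbol\gamma}\boldsymbol\gamma+\boldsymbol\epsilon$, $\boldsymbol\epsilon\sim N(\mathbf 0,\sigma^2\boldsymbol\Sigma)$, with $\mathbf y\in\mathbb R^n$, $\boldsymbol\theta\in\mathbb R^{r_1}$ ($r_1\ge1$) the tested parameters, $\boldsymbol\gamma\in\mathbb R^{r_2}$ ($r_2\ge0$) nuisance parameters, $n>r_1+r_2$, $\boldsymbol\Sigma$ a known positive definite matrix, $[\mathbf X_{\boldsymbol\theta}\ \mathbf X_{\boldsymbol\gamma}]$ of full column rank, and $\mathbf X_{\boldsymbol\theta}'\boldsymbol\Sigma^{-1}\mathbf X_{\boldsymbol\gamma}=\mathbf 0$.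 Let $\mathcal I=\mathbf X_{\boldsymbol\theta}'\boldsymbol\Sigma^{-1}\mathbf X_{\boldsymbol\theta}$, $\hat{\boldsymbol\theta}=\mathcal I^{-1}\mathbf X_{\boldsymbol\theta}'\boldsymbol\Sigma^{-1}\mathbf y$ (the ML estimate), and let $s_{\mathbf y}^2=(\mathbf y-\mathbf X_{\boldsymbol\theta}\hat{\boldsymbol\theta}-\mathbf X_{\boldsymbol\gamma}\hat{\boldsymbol\gamma})'\boldsymbol\Sigma^{-1}(\mathbf y-\mathbf X_{\boldsymbol\theta}\hat{\boldsymbol\theta}-\mathbf X_{\boldsymbol\gamma}\hat{\boldsymbol\gamma})$. $\boldsymbol\Omega$ is a fixed positive definite $r_1\times r_1$ matrix, $\nu_t\ge 0$, $s_t>0$; $\text{inv-}\chi^2(s^2,\nu)$ has density proportional to $(\sigma^2)^{-\nu/2-1}e^{-\nu s^2/(2\sigma^2)}$, with $\nu=0$ denoting the improper prior $\sigma^{-2}$. For fixed $g$ the Bayes factor (ratio of marginal likelihoods) is $$B_{10}(g)=C_1(g)\frac{\left(s_1^2\nu_1+s_{\mathbf y}^2+\hat{\boldsymbol\theta}'(\mathcal I^{-1}+g\boldsymbol\Omega)^{-1}\hat{\boldsymbol\theta}\right)^{-(n+\nu_1-r_2)/2}}{\left(s_0^2\nu_0+s_{\mathbf y}^2+\hat{\boldsymbol\theta}'\mathcal I\hat{\boldsymbol\theta}\right)^{-(n+\nu_0-r_2)/2}},\qquad C_1(g)=\frac{\kappa_1\Gamma(\frac{n+\nu_1-r_2}{2})}{\kappa_0\Gamma(\frac{n+\nu_0-r_2}{2})}2^{(\nu_1-\nu_0)/2}|g\boldsymbol\Omega+\mathcal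 I^{-1}|^{-1/2}|\mathcal I|^{-1/2},$$ with $\kappa_t=(\nu_t/2)^{\nu_t/2}s_t^{\nu_t}/\Gamma(\nu_t/2)$ if $\nu_t>0$ and $\kappa_t=1$ if $\nu_t=0$. Definition: a Bayes factor $B_{10}$ is information inconsistent if there exists a sequence of possible data with corresponding $|\hat{\boldsymbol\theta}_i|\to\infty$ as $i\to\infty$ along which $B_{10}<B_{10}^*$ for some constant $B_{10}^*<\infty$; otherwise (i.e. $B_{10}\to\infty$ whenever $|\hat{\boldsymbol\theta}|\to\infty$) it is information consistent. All other quantities ($n$, design, $\boldsymbol\Sigma$, hyperparameters, $s_{\mathbf y}^2>0$) are held fixed along the sequence. *)

(* Defs.v *)
From HB Require Import structures.
From mathcomp Require Export all_boot all_order all_algebra.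
From mathcomp Require Export all_classical all_reals all_analysis.

Set Implicit Arguments.
Unset Strict Implicit.
Unset Printing Implicit Defensive.

Export Order.TTheory GRing.Theory Num.Theory.
Export numFieldNormedType.Exports.

Local Open Scope classical_set_scope.
Local Open Scope ring_scope.

Section LinearModel.
Context {R : realType}.

Definition qform k (A : 'M[R]_k) (x : 'cV[R]_k) : R := (x^T *m A *m x) 0 0.

Definition posdef k (A : 'M[R]_k) : Prop :=
  A^T = A /\ forall x : 'cV[R]_k, x != 0 -> 0 < qform A x.

(* The norm [`|x|] of the library on matrices is the sup norm. *)
Definition enorm k (x : 'cV[R]_k) : R := Num.sqrt (\sum_(i < k) x i 0 ^+ 2).

Definition Gamma (a : R) : R :=
  \int[lebesgue_measure]_(x in `]0, +oo[) (x `^ (a - 1) * expR (- x)).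

Definition information_mx n k (Sigma : 'M[R]_n) (X : 'M[R]_(n, k)) : 'M[R]_k :=
  X^T *m invmx Sigma *m X.

(* In the model [y = X_theta theta + X_gamma gamma + eps] with
   [X_theta^T Sigma^-1 X_gamma = 0], the normal equations decouple, so this
   formula gives the ML estimate of either block of parameters from its own
   block of the design. *)
Definition ml_estimate n k (Sigma : 'M[R]_n) (X : 'M[R]_(n, k))
    (y : 'cV[R]_n) : 'cV[R]_k :=
  invmx (information_mx Sigma X) *m X^T *m invmx Sigma *m y.

Definition residual_ss n r1 r2 (Sigma : 'M[R]_n) (Xt : 'M[R]_(n, r1))
    (Xg : 'M[R]_(n, r2)) (y : 'cV[R]_n) : R :=
  qform (invmx Sigma)
    (y - Xt *m ml_estimate Sigma Xt y - Xg *m ml_estimate Sigma Xg y).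

(* Normalizing constant of the inv-chi^2(s^2, nu) density
   [kappa * (sigma^2)^(- nu/2 - 1) * exp (- nu s^2 / (2 sigma^2))];
   for [nu = 0] the prior is the improper [sigma^-2], taken with constant 1. *)
Definition kappa (nu s : R) : R :=
  if 0 < nu then (nu / 2) `^ (nu / 2) * s `^ nu / Gamma (nu / 2) else 1.

(* Ratio of the marginal likelihoods of [y] under
   H1 : theta | g, gamma, sigma^2 ~ N(0, g sigma^2 Omega), gamma flat,
        sigma^2 ~ inv-chi^2(s1^2, nu1), and
   H0 : theta = 0, gamma flat, sigma^2 ~ inv-chi^2(s0^2, nu0),
   with gamma, theta and sigma^2 integrated out in closed form. *)
Definition bayes_factor_const n r1 r2 (Sigma : 'M[R]_n) (Xt : 'M[R]_(n, r1))
    (Omega : 'M[R]_r1) (nu0 s0 nu1 s1 : R) (g : R) : R :=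
  let I := information_mx Sigma Xt in
  (kappa nu1 s1 * Gamma ((n%:R + nu1 - r2%:R) / 2))
    / (kappa nu0 s0 * Gamma ((n%:R + nu0 - r2%:R) / 2))
  * 2 `^ ((nu1 - nu0) / 2)
  * (\det (g *: Omega + invmx I)) `^ (- (1 / 2))
  * (\det I) `^ (- (1 / 2)).

Definition bayes_factor n r1 r2 (Sigma : 'M[R]_n) (Xt : 'M[R]_(n, r1))
    (Xg : 'M[R]_(n, r2)) (Omega : 'M[R]_r1) (nu0 s0 nu1 s1 : R)
    (g : R) (y : 'cV[R]_n) : R :=
  let I := information_mx Sigma Xt in
  let th := ml_estimate Sigma Xt y in
  let ss := residual_ss Sigma Xt Xg y in
  bayes_factor_const r2 Sigma Xt Omega nu0 s0 nu1 s1 g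
  * ((s1 ^+ 2 * nu1 + ss + qform (invmx (invmx I + g *: Omega)) th)
        `^ (- ((n%:R + nu1 - r2%:R) / 2))
     / (s0 ^+ 2 * nu0 + ss + qform I th)
        `^ (- ((n%:R + nu0 - r2%:R) / 2))).

(* The supremum is taken in the extended reals, where it always exists. *)
Definition sup_bayes_factor n r1 r2 (Sigma : 'M[R]_n) (Xt : 'M[R]_(n, r1))
    (Xg : 'M[R]_(n, r2)) (Omega : 'M[R]_r1) (nu0 s0 nu1 s1 : R)
    (y : 'cV[R]_n) : \bar R :=
  ereal_sup [set (bayes_factor Sigma Xt Xg Omega nu0 s0 nu1 s1 g y)%:E
            | g in [set g : R | 0 < g]].

(* [B] maps data to the value of the Bayes factor. Along the sequence of data
   the residual sum of squares stays at a fixed positive value [ss]. *)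
Definition information_inconsistent n r1 r2 (Sigma : 'M[R]_n)
    (Xt : 'M[R]_(n, r1)) (Xg : 'M[R]_(n, r2)) (B : 'cV[R]_n -> \bar R) : Prop :=
  exists (y : nat -> 'cV[R]_n) (ss : R),
    [/\ 0 < ss,
        forall i, residual_ss Sigma Xt Xg (y i) = ss,
        enorm (ml_estimate Sigma Xt (y i)) @[i --> \oo] --> +oo
      & exists Bstar : R, forall i, (B (y i) < Bstar%:E)%E].

Definition information_consistent n r1 r2 (Sigma : 'M[R]_n)
    (Xt : 'M[R]_(n, r1)) (Xg : 'M[R]_(n, r2)) (B : 'cV[R]_n -> \bar R) : Prop :=
  ~ information_inconsistent Sigma Xt Xg B.

End LinearModel.

(* Main.v *)
Require Import Defs.
From mathcomp Require Import perm measurable_realfun ring lra.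

Set Implicit Arguments.
Unset Strict Implicit.
Unset Printing Implicit Defensive.

Local Open Scope classical_set_scope.
Local Open Scope ring_scope.

(** The supremum over [g] dominates the value at any single [g], which may be
    chosen after seeing the data. Write [T] for the Euclidean norm of the
    estimate [th] and take [g = T ^+ 2], the scale at which the prior on theta
    covers the estimate. Three growth rates then decide the matter:

    - the quadratic form under H1, [th^T (I^-1 + g Omega)^-1 th], is at most
      [th^T Omega^-1 th / g] and so stays bounded
      ([qform_inv_shift_le], [qform_le]): H1 fits the data equally well
      however large [th] is;
    - the quadratic form under H0, [th^T I th], is at least a positive multiple
      of [T ^+ 2] ([qform_coercive]), so that H0 pays a factor of order
      [T `^ (n + nu0 - r2)];
    - the price of the diffuse prior is the determinant factor
      [\det (g Omega + I^-1) `^ (- 1/2)], of order at least [T `^ (- r1)],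
      because the determinant is at most a multiple of [g ^+ r1]
      ([det_shift_le]).

    The Bayes factor at this [g] is therefore at least a constant times
    [T `^ (n + nu0 - r2 - r1)], and the exponent is at least 1 since
    [r1 + r2 < n] ([bayes_factor_ge]). The constant is positive only if the
    normalizing constants are, which needs the Gamma integral to be finite as
    well as positive: the real-valued integral of a function with infinite
    integral is 0 ([Gamma_gt0]).

    The bounds on quadratic forms all rest on one inequality,
    [2 x^T w <= x^T A x + w^T A^-1 w] ([qform_young]), which replaces any
    appeal to eigenvalues or to compactness of the sphere. *)

(** * Finiteness and positivity of the Gamma integral *)

(** This is [z <= expR z] at [z = y / p], raised to the power [p]. *)
Lemma powR_le_expR (R : realType) (p y : R) :
  0 < p -> 0 < y -> y `^ p <= p `^ p * expR y.
Proof.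
move=> p0 y0.
have z0 : 0 < y / p by rewrite divr_gt0.
have -> : y = (y / p) * p by rewrite divfK ?gt_eqF.
rewrite expRM [in leLHS]mulrC powRM ?(ltW p0) ?(ltW z0)//.
rewrite ler_wpM2l ?powR_ge0// ge0_ler_powR ?nnegrE ?expR_ge0 ?(ltW p0) ?(ltW z0)//.
by rewrite (le_trans _ (expR_ge1Dx _))// lerDr.
Qed.

(** The derivative of [(x / (1 + x)) `^ a] for [0 < x], written with logarithms
    so that the chain rule applies directly. *)
Definition gamma_majorant (R : realType) (a x : R) : R :=
  a * (x^-1 - (1 + x)^-1) * expR (a * (ln x - ln (1 + x))).

Lemma gamma_majorant_derive (R : realType) (a x : R) : 0 < x ->
  is_derive x 1 (fun t => expR (a * (ln t - ln (1 + t)))) (gamma_majorant a x).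
Proof.
move=> x0.
have x1 : 0 < 1 + x by lra.
have d1 : is_derive (1 + x) (1:R) (@ln R) (1 + x)^-1 by exact: is_derive1_ln.
have d2 : is_derive x (1:R) (@ln R) x^-1 by exact: is_derive1_ln.
have d3 : is_derive x (1:R) (fun t : R => 1 + t) 1.
  have := is_deriveD (is_derive_cst (1 : R) x 1) (is_derive_id x (1:R)).
  by rewrite add0r.
have d4 : is_derive x (1:R) (fun t : R => ln (1 + t)) (1 + x)^-1.
  apply: (@is_derive_eq _ _ _ _ _ _ _ _ (@is_derive1_comp R (@ln R) (fun t => 1 + t) x _ _ d1 d3)).
  by rewrite mulr1.
have d5 : is_derive x (1:R) (fun t : R => a * (ln t - ln (1 + t)))
    (a * (x^-1 - (1 + x)^-1)).
  have := @is_deriveZ _ _ _ _ a _ _ _ (@is_deriveB _ _ _ _ _ _ _ _ _ d2 d4).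
  by [].
apply: (@is_derive_eq _ _ _ _ _ _ _ _ (@is_derive1_comp R (@expR R) _ x _ _ (is_derive_expR _) d5)).
by rewrite /gamma_majorant mulrC.
Qed.

Lemma gamma_majorant_continuous (R : realType) (a x : R) : 0 < x ->
  {for x, continuous (gamma_majorant a)}.
Proof.
move=> x0.
have x1 : 0 < 1 + x by lra.
have c1 : (fun t : R => 1 + t) @ x --> 1 + x.
  by apply: cvgD; [exact: cvg_cst|exact: cvg_id].
apply: cvgM.
  apply: cvgM; first exact: cvg_cst.
  apply: cvgB; apply: cvgV => //; [by lra | by lra].
apply: continuous_cvg; first exact: continuous_expR.
apply: cvgM; first exact: cvg_cst.
apply: cvgB; first exact: continuous_ln.
by apply: continuous_cvg => //; exact: continuous_ln.
Qed.

(** The majorant equals [a * x `^ (a - 1) / (1 + x) `^ (a + 1)]: it has the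
    singularity of the integrand at 0, and its polynomial decay at infinity
    is slower than the exponential one. *)
Lemma gamma_integrand_le (R : realType) (a x : R) : 0 < a -> 0 < x ->
  x `^ (a - 1) * expR (- x)
    <= ((a + 1) `^ (a + 1) * expR 1 / a) * gamma_majorant a x.
Proof.
move=> a0 x0.
have x1 : 0 < 1 + x by lra.
have a1 : 0 < a + 1 by lra.
have Y : 0 < (1 + x) `^ (a + 1) by exact: powR_gt0.
have -> : gamma_majorant a x = a * x `^ (a - 1) / (1 + x) `^ (a + 1).
  rewrite /gamma_majorant (mulrBr a (ln x)) expRD.
  have E z : 0 < z -> expR (a * ln z) = z `^ a by move=> z0; rewrite /powR gt_eqF.
  rewrite expRN !E//.
  have powRS z b : 0 < z -> z `^ (b + 1) = z `^ b * z.
    by move=> z0; rewrite powRD ?powRr1 ?(ltW z0)// (gt_eqF z0) implybT.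
  have -> : x `^ a = x `^ (a - 1) * x by rewrite -powRS// subrK.
  rewrite powRS//.
  have Ya : (1 + x) `^ a != 0 by rewrite gt_eqF// powR_gt0.
  by field; rewrite Ya; lra.
have -> : (a + 1) `^ (a + 1) * expR 1 / a * (a * x `^ (a - 1) / (1 + x) `^ (a + 1))
   = x `^ (a - 1) * ((a + 1) `^ (a + 1) * expR 1 / (1 + x) `^ (a + 1)).
  by field; rewrite !gt_eqF.
rewrite ler_wpM2l ?powR_ge0// ler_pdivlMr//.
have -> : expR 1 = expR (- x) * expR (1 + x) :> R.
  by rewrite -expRD; congr expR; ring.
rewrite mulrCA ler_wpM2l ?expR_ge0//.
exact: powR_le_expR.
Qed.

Lemma measurable_gamma_integrand (R : realType) (a : R) (A : set R) :
  measurable_fun A (fun x : R => x `^ (a - 1) * expR (- x)).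
Proof.
apply/measurable_funTS/measurable_funM; first exact: measurable_powR.
by apply: measurableT_comp.
Qed.

(** The primitive [(x / (1 + x)) `^ a] of the majorant takes its values in
    [[0, 1]], hence a bound that does not depend on the interval. Staying away
    from 0 keeps the majorant continuous when [a < 1]. *)
Lemma gamma_integral_le_itv (R : realType) (a : R) (k : nat) : 0 < a ->
  (\int[lebesgue_measure]_(x in `[(k.+2%:R^-1 : R)%R, (k.+2%:R)%R])
     (x `^ (a - 1) * expR (- x))%:E
   <= ((a + 1) `^ (a + 1) * expR 1 / a)%:E)%E.
Proof.
move=> a0; set C := (_ / a).
have C0 : 0 < C by rewrite divr_gt0// mulr_gt0 ?powR_gt0 ?expR_gt0//; lra.
set u : R := _^-1; set v : R := _%:R.
have v1 : 1 < v by rewrite ltr1n.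
have u0 : 0 < u by rewrite invr_gt0; lra.
have uv : u < v by rewrite (@lt_trans _ _ 1)// invf_lt1//; lra.
have inuv (x : R) : x \in `[u, v] -> 0 < x.
  by rewrite in_itv/= => /andP[ux _]; exact: lt_le_trans ux.
pose H (t : R) := expR (a * (ln t - ln (1 + t))).
have H1 (t : R) : 0 < t -> H t <= 1.
  move=> t0; rewrite -expR0 ler_expR pmulr_rle0// subr_le0 ler_ln ?posrE//; lra.
have cH (x : R) : 0 < x -> {for x, continuous (fun x => C * gamma_majorant a x)}.
  by move=> x0; apply: cvgM; [exact: cvg_cst|exact: gamma_majorant_continuous].
have cf : {within `[u, v], continuous (fun x => C * gamma_majorant a x)}.
  by apply: continuous_in_subspaceT => x /set_mem/inuv; exact: cH.
have dH (x : R) : 0 < x -> is_derive x 1 (fun t : R => C * H t) (C * gamma_majorant a x).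
  by move=> x0; exact: (@is_deriveZ _ _ _ _ C _ _ _ (gamma_majorant_derive a x0)).
have contH (x : R) : 0 < x -> {for x, continuous (fun t : R => C * H t)}.
  by move=> x0; apply/differentiable_continuous/derivable1_diffP; case: (dH _ x0).
apply: (@le_trans _ _ (\int[lebesgue_measure]_(x in `[u, v]) (C * gamma_majorant a x)%:E)%E).
  apply: ge0_le_integral => //=.
  - by move=> x _; rewrite lee_fin mulr_ge0 ?powR_ge0 ?expR_ge0.
  - apply/measurable_EFinP; apply: measurable_gamma_integrand.
  - apply/measurable_EFinP.
    exact: subspace_continuous_measurable_fun.
  - by move=> x /inuv x0; rewrite lee_fin gamma_integrand_le.
rewrite (@continuous_FTC2 _ _ (fun t => C * H t))//.
- rewrite -EFinB lee_fin.
  have := H1 v; have : 0 <= H u by exact: expR_ge0.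
  by nra.
- split.
  + by move=> x /subset_itv_oo_cc/inuv/dH[].
  + by apply: cvg_at_right_filter; exact: contH.
  + by apply: cvg_at_left_filter; apply: contH; lra.
- by move=> x /subset_itv_oo_cc/inuv/dH[? <-]; rewrite derive1E.
Qed.

Lemma bigcup_itv_invn (R : realType) :
  \bigcup_k [set` `[(k.+2%:R^-1 : R), k.+2%:R]] = [set` `]0, +oo[].
Proof.
apply/seteqP; split => [x [k _]|x] /=; rewrite !in_itv/= ?andbT.
  by move=> /andP[kx _]; rewrite (lt_le_trans _ kx)// invr_gt0.
move=> x0; pose k := Num.truncn (x + x^-1).
have x'0 : 0 < x^-1 by rewrite invr_gt0.
have kP : x + x^-1 <= k.+2%:R.
  by rewrite ltW// (lt_trans (truncnS_gt _))// ltr_nat.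
exists k => //=; rewrite in_itv/=; apply/andP; split; last by lra.
by rewrite invf_ple ?posrE ?ltr0n//; lra.
Qed.

(** The bound of [gamma_integral_le_itv], uniform in the interval, passes to the
    limit along an increasing sequence of intervals that exhausts the domain. *)
Lemma gamma_integral_fin (R : realType) (a : R) : 0 < a ->
  (\int[lebesgue_measure]_(x in `]0%R, +oo[) (x `^ (a - 1) * expR (- x))%:E
    < +oo)%E.
Proof.
move=> a0.
apply: (@le_lt_trans _ _ ((a + 1) `^ (a + 1) * expR 1 / a)%:E); last exact: ltry.
rewrite -bigcup_itv_invn.
set f : R -> \bar R := fun x => _; set F := fun k : nat => _.
have cvg_int : (\int[lebesgue_measure]_(x in F k) f x @[k --> \oo]
    --> \int[lebesgue_measure]_(x in \bigcup_k F k) f x)%E.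
  apply: ge0_nondecreasing_set_cvg_integral.
  - apply/nondecreasing_seqP => k; rewrite subsetEset; apply: subset_itv; rewrite bnd_simp.
      by rewrite lef_pV2 ?posrE// ler_nat.
    by rewrite ler_nat.
  - by move=> k; exact: measurable_itv.
  - move=> k; apply/measurable_EFinP; apply: measurable_gamma_integrand.
  - by move=> k x _; rewrite lee_fin mulr_ge0 ?powR_ge0 ?expR_ge0.
apply: (cvge_to_le cvg_int); apply: nearW => k.
exact: gamma_integral_le_itv.
Qed.

Lemma Gamma_gt0 (R : realType) (a : R) : 0 < a -> 0 < Gamma a.
Proof.
move=> a0; rewrite /Gamma /Rintegral.
rewrite fine_gt0// gamma_integral_fin// andbT.
(* On [[1, 2]] the integrand is at least [x^-1 * expR (- x)], whatever [a]. *)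
apply: (@lt_le_trans _ _ (\int[lebesgue_measure]_(x in `[1%R, 2%R]) (2^-1 * expR (- 2))%:E)%E).
  rewrite integral_cst//= lebesgue_measure_itv/= lte_fin ltr1n/=.
  by rewrite -EFinB -EFinM lte_fin !mulr_gt0 ?expR_gt0 ?invr_gt0//; lra.
apply: (@le_trans _ _ (\int[lebesgue_measure]_(x in `[1%R, 2%R]) (x `^ (a - 1) * expR (- x))%:E)%E).
  apply: ge0_le_integral => //=.
  - apply/measurable_EFinP; apply: measurable_gamma_integrand.
  - move=> x; rewrite in_itv/= => /andP[x1 x2]; rewrite lee_fin.
    rewrite ler_pM ?expR_ge0 ?invr_ge0 ?ler_expR ?lerN2//.
    apply: (@le_trans _ _ (x `^ (-1))); last by rewrite ler_powR//; lra.
    by rewrite powR_inv1; last lra; rewrite lef_pV2 ?posrE//; lra.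
apply: ge0_subset_integral => //=.
- apply/measurable_EFinP; apply: measurable_gamma_integrand.
- by move=> x _; rewrite lee_fin mulr_ge0 ?powR_ge0 ?expR_ge0.
- by move=> x /=; rewrite !in_itv/= andbT => /andP[x1 _]; lra.
Qed.

(** * Positive definite quadratic forms *)

Lemma qformE (R : realType) k (A : 'M[R]_k) (x : 'cV[R]_k) :
  qform A x = \sum_i \sum_j x j 0 * A j i * x i 0.
Proof.
rewrite /qform mxE; apply: eq_bigr => i _; rewrite mxE big_distrl /=.
by apply: eq_bigr => j _; rewrite mxE.
Qed.

(** A row vector killed by [A] would make the quadratic form vanish. *)
Lemma posdef_unit (R : realType) k (A : 'M[R]_k) : posdef A -> A \in unitmx.
Proof.
move=> [_ Apos]; rewrite -row_free_unit -kermx_eq0; apply/eqP/row_matrixP => i.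
rewrite row0; apply/eqP/negP => /negP x0.
have := Apos (row i (kermx A))^T; rewrite /qform trmxK.
have /sub_kermxP -> := row_sub i (kermx A).
rewrite mul0mx mxE ltxx => H; suff : false by [].
by apply: H; rewrite -trmx0 (inj_eq trmx_inj).
Qed.

Lemma qform_ge0 (R : realType) k (A : 'M[R]_k) x : posdef A -> 0 <= qform A x.
Proof.
move=> [_ Apos]; have [->|x0] := eqVneq x 0; last by rewrite ltW ?Apos.
by rewrite /qform mulmx0 mxE.
Qed.

Lemma posdef_congr (R : realType) n k (A : 'M[R]_n) (X : 'M[R]_(n, k)) :
  posdef A -> (forall x : 'cV[R]_k, X *m x = 0 -> x = 0) ->
  posdef (X^T *m A *m X).
Proof.
move=> [As Apos] Xinj; split; first by rewrite !trmx_mul trmxK As mulmxA.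
move=> x x0; have -> : qform (X^T *m A *m X) x = qform A (X *m x).
  by rewrite /qform trmx_mul !mulmxA.
by apply: Apos; apply: contra_neq x0; exact: Xinj.
Qed.

(** [A^-1] is the congruence transform of [A] by [A^-1] itself. *)
Lemma posdef_inv (R : realType) k (A : 'M[R]_k) : posdef A -> posdef (invmx A).
Proof.
move=> hA; have uA := posdef_unit hA.
have As : (invmx A)^T = invmx A by rewrite trmx_inv (proj1 hA).
have -> : invmx A = (invmx A)^T *m A *m invmx A by rewrite As mulVmx// mul1mx.
apply: posdef_congr => // x Ax0.
by rewrite -[x]mul1mx -(mulmxV uA) -mulmxA Ax0 mulmx0.
Qed.

Lemma qformD (R : realType) k (A B : 'M[R]_k) x :
  qform (A + B) x = qform A x + qform B x.
Proof. by rewrite /qform mulmxDr mulmxDl mxE. Qed.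

Lemma qformZ (R : realType) k (c : R) (A : 'M[R]_k) x :
  qform (c *: A) x = c * qform A x.
Proof. by rewrite /qform -scalemxAr -scalemxAl mxE. Qed.

Lemma posdefD (R : realType) k (A B : 'M[R]_k) :
  posdef A -> posdef B -> posdef (A + B).
Proof.
move=> hA hB; split; first by rewrite linearD /= (proj1 hA) (proj1 hB).
by move=> x x0; rewrite qformD addr_gt0 ?(proj2 hA) ?(proj2 hB).
Qed.

Lemma posdefZ (R : realType) k (c : R) (A : 'M[R]_k) :
  0 < c -> posdef A -> posdef (c *: A).
Proof.
move=> c0 hA; split; first by rewrite linearZ /= (proj1 hA).
by move=> x x0; rewrite qformZ mulr_gt0 ?(proj2 hA).
Qed.

(** The Fenchel-Young inequality of a positive definite form: the difference of
    the two sides is [qform A (x - A^-1 w)]. *)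
Lemma qform_young (R : realType) k (A : 'M[R]_k) (x w : 'cV[R]_k) :
  posdef A -> 2 * (x^T *m w) 0 0 <= qform A x + qform (invmx A) w.
Proof.
move=> hA; have uA := posdef_unit hA.
have := qform_ge0 (x - invmx A *m w) hA.
have As : (invmx A)^T = invmx A by rewrite trmx_inv (proj1 hA).
have -> : qform A (x - invmx A *m w)
    = qform A x - (x^T *m w) 0 0 - (w^T *m x) 0 0 + qform (invmx A) w.
  rewrite /qform.
  have -> : (x - invmx A *m w)^T = x^T - w^T *m invmx A.
    by rewrite raddfB /= trmx_mul As.
  rewrite !mulmxBl !mulmxBr !mulmxA.
  rewrite -(mulmxA _ A (invmx A)) -(mulmxA _ (invmx A) A) mulmxV// mulVmx// !mulmx1.
  by rewrite !mxE; ring.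
have -> : (w^T *m x) 0 0 = (x^T *m w) 0 0.
  by rewrite -[w^T *m x]trmxK trmx_mul trmxK mxE.
by lra.
Qed.

Lemma enorm_ge0 (R : realType) k (x : 'cV[R]_k) : 0 <= enorm x.
Proof. exact: sqrtr_ge0. Qed.

Lemma sqr_enorm (R : realType) k (x : 'cV[R]_k) : enorm x ^+ 2 = (x^T *m x) 0 0.
Proof.
rewrite /enorm sqr_sqrtr ?sumr_ge0// => [|i _]; last exact: sqr_ge0.
by rewrite mxE; apply: eq_bigr => i _; rewrite mxE expr2.
Qed.

Lemma qform_le (R : realType) k (A : 'M[R]_k) :
  exists2 c : R, 0 < c & forall x, qform A x <= c * enorm x ^+ 2.
Proof.
have entry (x : 'cV[R]_k) i : `|x i 0| <= enorm x.
  rewrite -sqrtr_sqr ler_wsqrtr// (bigD1 i)//= lerDl sumr_ge0// => j _.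
  exact: sqr_ge0.
exists (1 + \sum_i \sum_j `|A j i|).
  by rewrite ltr_pwDl// !sumr_ge0// => i _; rewrite sumr_ge0.
move=> x; rewrite mulrDl mul1r ler_wpDl ?sqr_ge0//.
rewrite qformE big_distrl /=; apply: ler_sum => i _.
rewrite big_distrl /=; apply: ler_sum => j _.
rewrite (le_trans (ler_norm _))// !normrM mulrAC mulrC ler_wpM2l//.
by rewrite expr2 ler_pM.
Qed.

(** A bound [qform (invmx A) x <= c * enorm x ^+ 2] for the inverse dualizes to
    a lower bound for [A]: apply [qform_young] with [w = c^-1 *: x], the
    multiple of [x] that optimizes the resulting constant. *)
Lemma qform_coercive (R : realType) k (A : 'M[R]_k) : posdef A ->
  exists2 c : R, 0 < c & forall x, c * enorm x ^+ 2 <= qform A x.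
Proof.
move=> hA; have [c c0 cP] := qform_le (invmx A).
exists c^-1; first by rewrite invr_gt0.
move=> x; have := qform_young x (c^-1 *: x) hA.
rewrite -scalemxAr mxE -sqr_enorm.
have -> : qform (invmx A) (c^-1 *: x) = c^-1 ^+ 2 * qform (invmx A) x.
  have xT : (c^-1 *: x)^T = c^-1 *: x^T by rewrite linearZ.
  by rewrite /qform xT -scalemxAr -!scalemxAl !mxE expr2 mulrA.
have : c^-1 ^+ 2 * qform (invmx A) x <= c^-1 * enorm x ^+ 2.
  apply: (@le_trans _ _ (c^-1 ^+ 2 * (c * enorm x ^+ 2))).
    by rewrite ler_wpM2l ?sqr_ge0.
  by rewrite mulrA expr2 mulfVK ?gt_eqF.
by lra.
Qed.

(** Inversion reverses the order of positive definite matrices, and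
    [J + g Omega] dominates [g Omega]. With [u = (J + g Omega)^-1 th], both
    [u^T th] and [qform (J + g Omega) u] are the left-hand side, so the claim is
    [qform_young] for [g Omega] at [u] and [th]. *)
Lemma qform_inv_shift_le (R : realType) k (J Omega : 'M[R]_k) (g : R) th :
  0 < g -> posdef J -> posdef Omega ->
  qform (invmx (J + g *: Omega)) th <= g^-1 * qform (invmx Omega) th.
Proof.
move=> g0 hJ hO; have hM := posdefD hJ (posdefZ g0 hO).
set M := J + _ in hM *; have uM := posdef_unit hM.
pose u := invmx M *m th.
have As : (invmx M)^T = invmx M by rewrite trmx_inv (proj1 hM).
have uE : qform (invmx M) th = (u^T *m th) 0 0.
  by rewrite /qform /u trmx_mul As.
have uE2 : qform (invmx M) th = qform M u.
  by rewrite /qform /u trmx_mul As -!mulmxA (mulmxA M) mulmxV// mul1mx.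
have := qform_young u th (posdefZ g0 hO).
have -> : qform (invmx (g *: Omega)) th = g^-1 * qform (invmx Omega) th.
  by rewrite invmxZ ?(posdef_unit (posdefZ g0 hO))// qformZ.
have : qform (g *: Omega) u <= qform M u by rewrite /M qformD lerDr qform_ge0.
by rewrite -uE -uE2; lra.
Qed.

(** Each term of the Leibniz formula is a product of [k] entries, all at most
    a constant times [g] once [1 <= g]. *)
Lemma det_shift_le (R : realType) k (J Omega : 'M[R]_k) :
  exists2 c : R, 0 < c & forall g, 1 <= g ->
    \det (g *: Omega + J) <= c * g ^+ k.
Proof.
pose K : R := \sum_i \sum_j (`|Omega i j| + `|J i j|).
have KP i j : `|Omega i j| + `|J i j| <= K.
  rewrite /K (bigD1 i)//= (bigD1 j)//= -addrA lerDl addr_ge0//.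
    by rewrite sumr_ge0// => *; rewrite addr_ge0.
  by rewrite sumr_ge0// => *; rewrite sumr_ge0// => *; rewrite addr_ge0.
exists (1 + \sum_(s : 'S_k) K ^+ k).
  rewrite ltr_pwDl// sumr_ge0// => *; rewrite exprn_ge0// /K.
  by rewrite sumr_ge0// => *; rewrite sumr_ge0// => *; rewrite addr_ge0.
move=> g g1; have g0 : 0 <= g by lra.
rewrite mulrDl mul1r ler_wpDl ?exprn_ge0// big_distrl /=.
apply: ler_sum => s _; rewrite (le_trans (ler_norm _))//.
rewrite normrM normrX normrN1 expr1n mul1r normr_prod -exprMn.
rewrite -[X in _ <= _ ^+ X]card_ord -prodr_const; apply: ler_prod => i _.
rewrite normr_ge0/= !mxE (le_trans (ler_normD _ _))// normrM (ger0_norm g0).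
have := KP i (s i); have := normr_ge0 (J i (s i)); have := normr_ge0 (Omega i (s i)).
by nra.
Qed.

Lemma full_rank_inj (R : realType) n r1 r2 (Xt : 'M[R]_(n, r1))
    (Xg : 'M[R]_(n, r2)) :
  \rank (row_mx Xt Xg) = (r1 + r2)%N ->
  forall x : 'cV[R]_r1, Xt *m x = 0 -> x = 0.
Proof.
move=> rk x Xx; have fr : row_free (row_mx Xt Xg)^T by rewrite /row_free mxrank_tr rk.
have : (col_mx x (0 : 'cV[R]_r2))^T *m (row_mx Xt Xg)^T = 0.
  by rewrite -trmx_mul mul_row_col Xx mulmx0 addr0 trmx0.
rewrite -[RHS](mul0mx _ (row_mx Xt Xg)^T) => /(row_free_inj fr)/(congr1 trmx).
by rewrite trmxK trmx0 -[RHS]col_mx0 => /eq_col_mx[].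
Qed.

(** [char_poly (- A)] takes the value [\det A] at 0 and is positive far to the
    right. If [\det A] were not positive, the intermediate value theorem would
    give a root [t >= 0], that is an eigenvalue [- t <= 0] of [A]. *)
Lemma det_posdef_gt0 (R : realType) k (A : 'M[R]_k) : posdef A -> 0 < \det A.
Proof.
move=> [_ Apos]; pose p := char_poly (- A).
have p0 : p.[0] = \det A.
  by rewrite horner_coef0 char_poly_det -(scaleN1r A) detZ mulrA -expr2 sqrr_sign mul1r.
rewrite ltNge -p0; apply/negP => p0_le0.
have [b pb] := monic_Cauchy_bound (char_poly_monic (- A)).
have [||t /andP[t0 _] pt] := @poly_ivt R p 0 (Num.max 0 b).
- by rewrite le_max lexx.
- by rewrite p0_le0 ltW// pb// le_max lexx orbT.
move: pt; rewrite -eigenvalue_root_char => /eigenvalueP[v vA v0].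
have := Apos v^T; rewrite /qform trmxK -[v *m A]opprK -mulmxN vA mulNmx -scalemxAl.
have -> : (- (t *: (v *m v^T))) 0 0 = - (t * enorm v^T ^+ 2).
  by rewrite sqr_enorm trmxK !mxE.
rewrite oppr_gt0 ltNge mulr_ge0 ?sqr_ge0// => H; suff : false by [].
by apply: H; rewrite -trmx0 (inj_eq trmx_inj).
Qed.

(** * Growth of the Bayes factor *)

Lemma le_powRN (R : realType) (p x y : R) : 0 <= p -> 0 < x -> x <= y ->
  y `^ (- p) <= x `^ (- p).
Proof.
move=> p0 x0 xy; have y0 : 0 < y by exact: lt_le_trans xy.
rewrite !powRN lef_pV2 ?posrE ?powR_gt0//.
by rewrite ge0_ler_powR ?nnegrE ?(ltW x0) ?(ltW y0).
Qed.

Lemma kappa_gt0 (R : realType) (nu s : R) : 0 < s -> 0 < kappa nu s.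
Proof.
move=> s0; rewrite /kappa; case: ifPn => // nu0.
by rewrite divr_gt0 ?mulr_gt0 ?powR_gt0 ?Gamma_gt0// divr_gt0.
Qed.

(** Once the residual sum of squares is fixed, the data enter every estimate
    only through [T], which is why [K] can be uniform in [y]. *)
Lemma bayes_factor_ge (R : realType) (n r1 r2 : nat)
    (Sigma : 'M[R]_n) (Xt : 'M[R]_(n, r1)) (Xg : 'M[R]_(n, r2))
    (Omega : 'M[R]_r1) (nu0 s0 nu1 s1 ss : R) :
  (r1 + r2 < n)%N -> posdef Sigma ->
  (forall x : 'cV[R]_r1, Xt *m x = 0 -> x = 0) -> posdef Omega ->
  0 <= nu0 -> 0 < s0 -> 0 <= nu1 -> 0 < s1 -> 0 < ss ->
  exists2 K : R, 0 < K & forall y, residual_ss Sigma Xt Xg y = ss ->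
    let T := enorm (ml_estimate Sigma Xt y) in
    1 <= T -> K * T <= bayes_factor Sigma Xt Xg Omega nu0 s0 nu1 s1 (T ^+ 2) y.
Proof.
move=> hn hSigma Xinj hO hnu0 hs0 hnu1 hs1 hss.
have hI : posdef (information_mx Sigma Xt).
  by apply: posdef_congr => //; exact: posdef_inv.
have hJ := posdef_inv hI.
set I := information_mx Sigma Xt in hI hJ.
have [c c0 cP] := qform_le (invmx Omega).
have [lam lam0 lamP] := qform_coercive hI.
have [d d0 dP] := det_shift_le (invmx I) Omega.
have df : r1%:R + r2%:R + 1 <= n%:R :> R by rewrite -natrD natr1 ler_nat.
have r1_ge0 : 0 <= r1%:R :> R := ler0n _ _.
pose N0 : R := (n%:R + nu0 - r2%:R) / 2.
pose N1 : R := (n%:R + nu1 - r2%:R) / 2.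
have N00 : 0 < N0 by rewrite /N0; lra.
have N10 : 0 < N1 by rewrite /N1; lra.
pose C := kappa nu1 s1 * Gamma N1 / (kappa nu0 s0 * Gamma N0)
          * 2 `^ ((nu1 - nu0) / 2).
have C0 : 0 < C.
  by rewrite mulr_gt0 ?powR_gt0// divr_gt0// mulr_gt0 ?kappa_gt0 ?Gamma_gt0.
pose K1 := s1 ^+ 2 * nu1 + ss + c.
have s1nu : 0 <= s1 ^+ 2 * nu1 by rewrite mulr_ge0 ?sqr_ge0.
have s0nu : 0 <= s0 ^+ 2 * nu0 by rewrite mulr_ge0 ?sqr_ge0.
have K10 : 0 < K1 by rewrite /K1; lra.
have detI := det_posdef_gt0 hI.
pose L := (\det I) `^ (- (1 / 2)).
have L0 : 0 < L by exact: powR_gt0.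
have K0 : 0 < C * d `^ (- (1 / 2)) * L * (K1 `^ (- N1) * lam `^ N0).
  exact: mulr_gt0 (mulr_gt0 (mulr_gt0 C0 (powR_gt0 _ d0)) L0)
    (mulr_gt0 (powR_gt0 _ K10) (powR_gt0 _ lam0)).
eexists; first exact: K0.
move=> y yss; set th := ml_estimate _ _ _ => T T1.
have T0 : 0 < T by lra.
have T20 : 0 < T ^+ 2 by exact: exprn_gt0.
have T21 : 1 <= T ^+ 2 by exact: exprn_ege1.
rewrite /bayes_factor yss -/I -/th /bayes_factor_const -/I -/N0 -/N1 -/C -/L.
set D := \det _; set A1 := (s1 ^+ 2 * nu1 + _ + _); set A0 := (s0 ^+ 2 * nu0 + _ + _).
have D0 : 0 < D by apply/det_posdef_gt0/posdefD => //; exact: posdefZ.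
have hD : d `^ (- (1 / 2)) * T `^ (- r1%:R) <= D `^ (- (1 / 2)).
  have -> : d `^ (- (1 / 2)) * T `^ (- r1%:R) = (d * (T ^+ 2) ^+ r1) `^ (- (1 / 2)).
    rewrite powRM ?(ltW d0) ?exprn_ge0 ?(ltW T0)//.
    rewrite -exprM -powR_mulrn ?(ltW T0)// -powRrM natrM.
    by congr (_ * _); congr (_ `^ _); lra.
  by apply: le_powRN => //; exact: dP.
have hA1 : K1 `^ (- N1) <= A1 `^ (- N1).
  have q0 : 0 <= qform (invmx (invmx I + T ^+ 2 *: Omega)) th.
    by apply/qform_ge0/posdef_inv/posdefD => //; exact: posdefZ.
  apply: le_powRN; [lra | by rewrite /A1; lra |].
  rewrite /A1 /K1 lerD2l (le_trans (qform_inv_shift_le th T20 hJ hO))//.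
  by rewrite mulrC ler_pdivrMr.
have hA0 : lam `^ N0 * T `^ (N0 * 2) <= (A0 `^ (- N0))^-1.
  rewrite -powRN opprK.
  have -> : T `^ (N0 * 2) = (T ^+ 2) `^ N0.
    by rewrite mulrC powRrM powR_mulrn ?(ltW T0).
  rewrite -powRM ?(ltW lam0) ?(ltW T20)//.
  have := lamP th; rewrite -/T => lamT.
  have lT : 0 <= lam * T ^+ 2 by rewrite mulr_ge0 ?ltW.
  by rewrite ge0_ler_powR ?nnegrE//; [lra| rewrite /A0; lra| rewrite /A0; lra].
(* The exponent is [n + nu0 - r2 - r1], at least 1 because [r1 + r2 < n]. *)
have hT : T <= T `^ (- r1%:R) * T `^ (N0 * 2).
  rewrite -powRD ?(gt_eqF T0) ?implybT//; apply: le1r_powR => //.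
  by rewrite /N0; lra.
apply: (@le_trans _ _ (C * d `^ (- (1 / 2)) * L * (K1 `^ (- N1) * lam `^ N0)
    * (T `^ (- r1%:R) * T `^ (N0 * 2)))).
  by rewrite ler_pM2l.
have -> : C * d `^ (- (1 / 2)) * L * (K1 `^ (- N1) * lam `^ N0)
    * (T `^ (- r1%:R) * T `^ (N0 * 2))
  = C * (d `^ (- (1 / 2)) * T `^ (- r1%:R)) * L
    * (K1 `^ (- N1) * (lam `^ N0 * T `^ (N0 * 2))) by ring.
apply: ler_pM.
- exact: mulr_ge0 (mulr_ge0 (ltW C0) (mulr_ge0 (powR_ge0 _ _) (powR_ge0 _ _)))
    (ltW L0).
- by rewrite !mulr_ge0 ?powR_ge0.
- by rewrite (ler_pM2r L0) (ler_pM2l C0).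
- by apply: ler_pM; rewrite ?mulr_ge0 ?powR_ge0.
Qed.

Theorem lemma5 (R : realType) (n r1 r2 : nat)
    (Sigma : 'M[R]_n) (Xt : 'M[R]_(n, r1)) (Xg : 'M[R]_(n, r2))
    (Omega : 'M[R]_r1) (nu0 s0 nu1 s1 : R)
    (hr1 : (1 <= r1)%N) (hn : (r1 + r2 < n)%N)
    (hSigma : posdef Sigma)
    (hrank : \rank (row_mx Xt Xg) = (r1 + r2)%N)
    (horth : Xt^T *m invmx Sigma *m Xg = 0)
    (hOmega : posdef Omega)
    (hnu0 : 0 <= nu0) (hs0 : 0 < s0) (hnu1 : 0 <= nu1) (hs1 : 0 < s1) :
  information_consistent Sigma Xt Xg
    (sup_bayes_factor Sigma Xt Xg Omega nu0 s0 nu1 s1).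
Proof.
move=> [y [ss [ss0 yss yoo [B BP]]]].
have [K K0 KP] := bayes_factor_ge Xg hn hSigma (full_rank_inj hrank) hOmega
  hnu0 hs0 hnu1 hs1 ss0.
have /cvgryPge/(_ (Num.max 1 (B / K)))[i _ /(_ i (leqnn i))] := yoo.
set T := enorm _; rewrite /= -/T ge_max => /andP[T1 BT].
have := BP i; rewrite ltNge => /negP; apply.
apply: (@le_trans _ _ (bayes_factor Sigma Xt Xg Omega nu0 s0 nu1 s1 (T ^+ 2) (y i))%:E).
  rewrite lee_fin (le_trans _ (KP _ (yss i) T1))//.
  by rewrite mulrC -ler_pdivrMr.
by apply: ereal_sup_ubound; exists (T ^+ 2) => //=; rewrite exprn_gt0//; lra.
Qed.
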